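(* Let $\mathcal{Q}\subset\mathbb{N}$ be a finite index set, let $\mathcal{D}\subseteq SO(3)\times\mathcal{Q}$, let $\delta>0$ and $k_c>0$, and let $\mathcal{U}\in\mathcal{P}_{\mathcal{D}}$ be a potential function on $\mathcal{D}$. Consider the hybrid closed-loop system with state $(R,q)\in SO(3)\times\mathcal{Q}$ consisting of $$\dot R=R[u_1]_\times,\qquad u_1=-k_c\,x_R(R,q),\qquad x_R(R,q):=\psi\big(R^\top\nabla\mathcal{U}(R,q)\big),$$ where $q$ is generated by $$\dot q=0\ \text{ for } (R,q)\in C,\qquad q^+\in\arg\min_{m\in\mathcal{Q}}\mathcal{U}(R,m)\ \text{ for } (R,q)\in D,$$ with $$C=\{(R,q):\ \mathcal{U}(R,q)-\min_{m\in\mathcal{Q}}\mathcal{U}(R,m)\le\delta\},\qquad D=\{(R,q):\ \mathcal{U}(R,q)-\min_{m\in\mathcal{Q}}\mathcal{U}(R,m)\ge\delta\}.$$ If $\mathcal{U}$ is exp-synergistic with gap exceeding $\delta$, then the set $\mathcal{A}=\{I\}\times\mathcal{Q}$ is globally exponentially stable for this hybrid system.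
   Context: Notation. $SO(3)=\{R\in\mathbb{R}^{3\times3}: \det R=1,\ RR^\top=I\}$, with tangent spaces $T_RSO(3)=\{R\Omega:\Omega\in\mathfrak{so}(3)\}$, where $\mathfrak{so}(3)$ is the space of skew-symmetric $3\times3$ matrices. The map $[\cdot]_\times:\mathbb{R}^3\to\mathfrak{so}(3)$ is defined by $[x]_\times y=x\times y$, and $\mathrm{vex}$ is its inverse. For $A\in\mathbb{R}^{3\times3}$, $\psi(A):=\mathrm{vex}((A-A^\top)/2)$. $|R|_I\in[0,1]$ is defined by $|R|_I^2=\mathrm{tr}(I-R)/4$. $\|\cdot\|_F$ is the Frobenius norm. Gradients $\nabla\mathcal{U}(R,q)\in T_RSO(3)$ are taken with respect to $R$, relative to the left-invariant Riemannian metric $\langle R\Omega_1,R\Omega_2\rangle_R=\mathrm{tr}(\Omega_1^\top\Omega_2)$. Potential functions. Let $\mathcal{A}=\{I\}\times\mathcal{Q}$ and $\mathcal{D}=\bigcup_{q\in\mathcal{Q}}D_q\times\{q\}\subseteq SO(3)\times\mathcal{Q}$. $\mathcal{P}_{\mathcal{D}}$ is the set of continuous functions $\mathcal{U}:SO(3)\times\mathcal{Q}\to\mathbb{R}^+$ ($\mathbb{R}^+$ = nonnegative reals) such that $\mathcal{U}(R,q)>0$ for $(R,q)\notin\mathcal{A}$, $\mathcal{U}(R,q)=0$ for $(R,q)\in\mathcal{A}$, and $\mathcal{U}$ is continuously differentiable on $\mathcal{D}$ (i.e. $R\mapsto\mathcal{U}(R,q)$ is $C^1$ on $D_q$ for each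 $q$). Exp-synergism. Given $\delta>0$ and $C:=\{(R,q)\in SO(3)\times\mathcal{Q}:\ \mathcal{U}(R,q)-\min_{m\in\mathcal{Q}}\mathcal{U}(R,m)\le\delta\}$, a function $\mathcal{U}\in\mathcal{P}_{\mathcal{D}}$ is exp-synergistic with gap exceeding $\delta$ if there exist constants $\alpha_1,\dots,\alpha_4>0$ such that: $\alpha_1|R|_I^2\le\mathcal{U}(R,q)\le\alpha_2|R|_I^2$ for all $(R,q)\in SO(3)\times\mathcal{Q}$; $\alpha_3|R|_I^2\le\|\nabla\mathcal{U}(R,q)\|_F^2\le\alpha_4|R|_I^2$ for all $(R,q)\in C$; and $C\subseteq\mathcal{D}$. Hybrid systems. Solutions are hybrid arcs on hybrid time domains $\subset[0,\infty)\times\mathbb{N}$, in the sense of Goebel–Sanfelice–Teel: the state may flow when $(R,q)\in C$ and may jump when $(R,q)\in D$; at jumps only $q$ changes and $R$ is unchanged. A set $S$ is globally exponentially stable if for every $r>0$ there are $\kappa,\lambda>0$ such that every solution $x$ whose initial distance to $S$ is at most $r$ satisfies $|x(t,j)|_S\le\kappa e^{-\lambda(t+j)}|x(0,0)|_S$ for all $(t,j)$ in its domain. Here the distance of $(R,q)$ to $\mathcal{A}$ is measured by $|R|_I$. *)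

(* Defs.v *)
From HB Require Import structures.
From mathcomp Require Import all_boot all_order all_algebra.
From mathcomp Require Import all_classical all_reals all_analysis.
From mathcomp Require Import ring lra.

Set Implicit Arguments.
Unset Strict Implicit.
Unset Printing Implicit Defensive.

Import Order.TTheory GRing.Theory Num.Theory.
Import numFieldNormedType.Exports.

Local Open Scope classical_set_scope.
Local Open Scope ring_scope.

Section RotationGroup.
Context {K : realType}.
Implicit Types (R A B G xi eta : 'M[K]_3) (x y : 'cV[K]_3).

Definition SO3 : set 'M[K]_3 := [set R | \det R = 1 /\ R *m R^T = 1%:M].

Definition so3 : set 'M[K]_3 := [set A | A^T = - A].

Definition tangent R : set 'M[K]_3 := [set R *m A | A in so3].

(* The sums [i + 1] and [i + 2] are taken in ['I_3], i.e. modulo 3. *)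
Definition crossmul x y : 'cV[K]_3 :=
  \col_(i < 3) (x (i + 1) 0 * y (i + 2%:R) 0 - x (i + 2%:R) 0 * y (i + 1) 0).

(* The matrix of [y |-> crossmul x y], see [hatE]. *)
Definition hat x : 'M[K]_3 :=
  \matrix_(i < 3, j < 3) crossmul x (delta_mx j 0) i 0.

(* Inverse of [hat] on [so3], see [vexK] and [hatK]. *)
Definition vex A : 'cV[K]_3 := \col_(i < 3) A (i + 2%:R) (i + 1).

Lemma hatE x y : hat x *m y = crossmul x y.
Proof.
apply/matrixP => i j; rewrite ord1 !mxE.
under eq_bigr => k _ do rewrite !mxE mulrBl -!mulrA.
rewrite sumrB; congr (_ - _); rewrite -mulr_sumr; congr (_ * _).
- rewrite (bigD1 (i + 2%:R)) //= !eqxx mul1r big1 ?addr0 // => k.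
  by rewrite eq_sym => /negbTE ->; rewrite mul0r.
- rewrite (bigD1 (i + 1)) //= !eqxx mul1r big1 ?addr0 // => k.
  by rewrite eq_sym => /negbTE ->; rewrite mul0r.
Qed.

Lemma hat_so3 x : so3 (hat x).
Proof.
apply/matrixP => i j; rewrite !mxE !eqxx !andbT.
have E k : x k 0 = x (inord k) 0 by rewrite inord_val.
rewrite (E (j + 1)) (E (j + 2%:R)) (E (i + 1)) (E (i + 2%:R)).
by case: i => [[|[|[|//]]] Hi]; case: j => [[|[|[|//]]] Hj] /=; ring.
Qed.

Lemma vexK x : vex (hat x) = x.
Proof.
apply/matrixP => i j; rewrite ord1 !mxE !eqxx !andbT.
have E k : x k 0 = x (inord k) 0 by rewrite inord_val.
rewrite (E i) (E (i + 2%:R + 1)) (E (i + 2%:R + 2%:R)).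
by case: i => [[|[|[|//]]] Hi] /=; ring.
Qed.

Lemma hatK A : so3 A -> hat (vex A) = A.
Proof.
move=> /matrixP hA; apply/matrixP => i j; rewrite !mxE !eqxx !andbT.
have E k l : A k l = A (inord k) (inord l) by rewrite !inord_val.
have hE (k l : 'I_3) : A (inord l) (inord k) = - A (inord k) (inord l).
  by have := hA (inord k) (inord l); rewrite !mxE.
have := hE 0 0; have := hE 1 1; have := hE 2%:R 2%:R.
have := hE 0 1; have := hE 0 2%:R; have := hE 1 2%:R.
rewrite (E i j) (E (i + 1 + 2%:R)) (E (i + 2%:R + 2%:R)).
by case: i => [[|[|[|//]]] Hi]; case: j => [[|[|[|//]]] Hj] /=; lra.
Qed.

Definition psi A : 'cV[K]_3 := vex (2^-1 *: (A - A^T)).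

Definition dist_I R : K := Num.sqrt (\tr (1%:M - R) / 4).

Definition frobenius A : K := Num.sqrt (\tr (A^T *m A)).

Definition metric R xi eta : K := \tr ((R^T *m xi)^T *m (R^T *m eta)).

(* [f] is differentiable at [R] as a function on the embedded submanifold [SO3]
   (it agrees near [R] on [SO3] with some [F] differentiable at [R] in the
   ambient space), and the tangent vector [G] represents the differential of
   [f] on the tangent space at [R]. Values of [f] outside [SO3] are irrelevant. *)
Definition is_gradient (f : 'M[K]_3 -> K) R G : Prop :=
  tangent R G /\
  exists F : 'M[K]_3 -> K,
    [/\ \forall S \near R, SO3 S -> F S = f S,
        differentiable F R &
        forall xi, tangent R xi -> 'd F R xi = metric R G xi].

End RotationGroup.

(* Functions on [SO3 `*` Q] are represented by total functions on [state];
   only their values on [SO3 `*` Q] are used. *)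
Notation state K := ('M[K]_3 * nat)%type.

Section Potential.
Context {K : realType}.
Variables (Q : set nat) (U : state K -> K).

Definition grad (x : state K) : 'M[K]_3 :=
  xget 0 [set G | is_gradient (fun S => U (S, x.2)) x.1 G].

Definition target : set (state K) := [set 1%:M] `*` Q.

Definition continuously_differentiable_on (Dom : set (state K)) : Prop :=
  (forall R q, Dom (R, q) -> exists G, is_gradient (fun S => U (S, q)) R G) /\
  (forall q, {within [set R | Dom (R, q)], continuous (fun R => grad (R, q))}).

Definition potential_function (Dom : set (state K)) : Prop :=
  [/\ {within SO3 `*` Q, continuous U},
      forall x, (SO3 `*` Q) x -> 0 <= U x,
      forall x, (SO3 `*` Q) x -> ~ target x -> 0 < U x,
      forall x, target x -> U x = 0 &
      continuously_differentiable_on Dom].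

(* [Q] being finite, and nonempty as soon as there is a state, the infimum is
   the minimum. *)
Definition minU (R : 'M[K]_3) : K := inf [set U (R, m) | m in Q].

Definition argminU (R : 'M[K]_3) : set nat :=
  [set m | Q m /\ forall p, Q p -> U (R, m) <= U (R, p)].

Definition flow_set (delta : K) : set (state K) :=
  [set x | (SO3 `*` Q) x /\ U x - minU x.1 <= delta].

Definition jump_set (delta : K) : set (state K) :=
  [set x | (SO3 `*` Q) x /\ U x - minU x.1 >= delta].

Definition exp_synergistic (Dom : set (state K)) (delta : K) : Prop :=
  exists a1 a2 a3 a4 : K,
    [/\ [/\ 0 < a1, 0 < a2, 0 < a3 & 0 < a4],
        forall x, (SO3 `*` Q) x ->
          a1 * dist_I x.1 ^+ 2 <= U x <= a2 * dist_I x.1 ^+ 2,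
        forall x, flow_set delta x ->
          a3 * dist_I x.1 ^+ 2 <= frobenius (grad x) ^+ 2
                               <= a4 * dist_I x.1 ^+ 2 &
        flow_set delta `<=` Dom].

Definition x_R (x : state K) : 'cV[K]_3 := psi (x.1^T *m grad x).

Definition closed_loop_flow (kc : K) (x : state K) : 'M[K]_3 :=
  x.1 *m hat (- (kc *: x_R x)).

Definition closed_loop_jump (x : state K) : set (state K) :=
  [set y | y.1 = x.1 /\ argminU x.1 y.2].

End Potential.

Section HybridSystems.
Context {K : realType}.

Definition compact_hybrid_time_domain (E : set (K * nat)) : Prop :=
  exists (J : nat) (t : nat -> K),
    [/\ t 0%N = 0, forall j, (j < J)%N -> t j <= t j.+1 &
        E = \bigcup_(j in [set j | (j < J)%N]) (`[t j, t j.+1] `*` [set j])].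

Definition hybrid_time_domain (E : set (K * nat)) : Prop :=
  E `<=` [set p | 0 <= p.1] /\
  forall T J, E (T, J) ->
    compact_hybrid_time_domain (E `&` [set p | p.1 <= T /\ (p.2 <= J)%N]).

Definition absolutely_continuous_on (V : normedModType K) (f : K -> V)
    (a b : K) : Prop :=
  forall e, 0 < e -> exists2 d, 0 < d &
    forall (n : nat) (s t : 'I_n -> K),
      (forall i, [/\ a <= s i, s i <= t i & t i <= b]) ->
      trivIset setT (fun i => `]s i, t i[%classic) ->
      \sum_(i < n) (t i - s i) < d ->
      \sum_(i < n) `|f (t i) - f (s i)| < e.

Definition locally_absolutely_continuous (V : normedModType K) (I : set K)
    (f : K -> V) : Prop :=
  forall a b, a <= b -> `[a, b] `<=` I -> absolutely_continuous_on f a b.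

Definition slice (E : set (K * nat)) (j : nat) : set K := [set t | E (t, j)].

(* An arc is a total function of which only the values on [E] matter. The
   discrete component is viewed as a real number, as in the general theory. *)
Definition hybrid_arc (E : set (K * nat)) (x : K * nat -> state K) : Prop :=
  hybrid_time_domain E /\
  forall j,
    locally_absolutely_continuous (slice E j) (fun t => (x (t, j)).1) /\
    locally_absolutely_continuous (slice E j)
      (fun t => ((x (t, j)).2%:R : K)).

(* Solutions, with values in [X], of the hybrid system
   (R', q') = (f (R, q), 0) on [C], (R, q)^+ \in g (R, q) on [D]. *)
Definition hybrid_solution (X C : set (state K)) (f : state K -> 'M[K]_3)
    (D : set (state K)) (g : state K -> set (state K))
    (E : set (K * nat)) (x : K * nat -> state K) : Prop :=
  [/\ hybrid_arc E x /\ (forall p, E p -> X (x p)),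
      E (0, 0%N) /\ (closure C `|` D) (x (0, 0%N)),
      forall j t, (slice E j)^° t -> C (x (t, j)),
      forall j, {ae lebesgue_measure, forall t : K, slice E j t ->
        is_derive t (1 : K) (fun s => (x (s, j)).1) (f (x (t, j))) /\
        is_derive t (1 : K) (fun s => ((x (s, j)).2%:R : K)) 0} &
      forall t j, E (t, j) -> E (t, j.+1) ->
        D (x (t, j)) /\ g (x (t, j)) (x (t, j.+1))].

Definition globally_exponentially_stable (dist : state K -> K)
    (sol : set (K * nat) -> (K * nat -> state K) -> Prop) : Prop :=
  forall r, 0 < r -> exists kappa lambda : K,
    [/\ 0 < kappa, 0 < lambda &
        forall E x, sol E x -> dist (x (0, 0%N)) <= r ->
          forall t j, E (t, j) ->
            dist (x (t, j)) <=
            kappa * expR (- lambda * (t + j%:R)) * dist (x (0, 0%N))].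

End HybridSystems.

(* Main.v *)
Require Import Defs.
From mathcomp Require Import all_boot all_order all_algebra.
From mathcomp Require Import all_classical all_reals all_analysis.
From mathcomp Require Import ring lra.
Import Order.TTheory GRing.Theory Num.Theory.
Import numFieldNormedType.Exports.
Local Open Scope classical_set_scope.
Local Open Scope ring_scope.

(** The potential [U] itself is a Lyapunov function.

    Along a flow, [R' = - kc *: grad U (R, q)], because [R^T *m grad U] is
    skew-symmetric and [hat \o psi] is the identity on [so3]. Hence
    [U' = - kc * frobenius (grad U) ^+ 2], which is at most [- c * U] with
    [c = kc * a3 / a2] by the two-sided bounds in [exp_synergistic]. At a
    jump, [U] drops to its minimum over the modes, so by at least [delta].
    Along a solution with initial distance at most [r], [U] never exceeds
    [M = a2 * r ^+ 2], and subtracting [delta] from a number in [[0, M]]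
    multiplies it by at most [1 - delta / M <= expR (- delta / M)]. Together,
    [U] at hybrid time [(t, j)] is at most [expR (- (c * t + delta / M * j))]
    times its initial value. Since [U] is comparable with the square of the
    distance, this gives [kappa = Num.sqrt (a2 / a1)] and, for [lambda], half
    of the smaller of the two rates; [lambda] depends on [r] only through [M].

    The delicate point is regularity. Solutions are absolutely continuous and
    satisfy the differential equation almost everywhere, while [U] is only
    differentiable at the points of a set [Dom] that need not be open, with
    extensions to the ambient space that depend on the point; so it is not
    clear that [U] is absolutely continuous along a solution. This is avoided
    by showing that flows are classical. The mean value inequality
    [mean_value_absolutely_continuous] implies that an absolutely continuous
    curve whose derivative agrees almost everywhere with a function continuous
    at [t] is differentiable at [t] ([is_derive_absolutely_continuous]).
    Inside a flow interval the curve stays in [Dom], where the gradient is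
    continuous, so the differential equation holds at every interior time. The
    chain rule ([is_derive_along_curve]) and the usual mean value theorem then
    give the decay of [U] ([flow_decay]), and an induction along the hybrid
    time domain combines it with the jumps. *)

(** * Absolutely continuous curves *)

(** An additive property of intervals that holds for all short intervals around
    each point holds globally: the supremum of the points reachable from [a]
    is itself reachable, and can be passed unless it is [b]. *)
Lemma cousin (K : realType) (P : K -> K -> Prop) (a b : K) :
  a <= b ->
  (forall s t r, s <= t -> t <= r -> P s t -> P t r -> P s r) ->
  (forall t, a <= t <= b -> exists2 h, 0 < h & forall s r,
     a <= s -> s <= t -> t <= r -> r <= b -> r - s < h -> P s r) ->
  P a b.
Proof.
move=> ab Pcat Ploc.
pose S := [set t | a <= t <= b /\ P a t].
have Sa : S a.
  have aab : a <= a <= b by rewrite lexx.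
  split=> //; have [h h0 Ph] := Ploc a aab.
  by apply: Ph; rewrite ?lexx // subrr.
have supS : has_sup S.
  by split; [exists a | exists b => t [/andP[]]].
have acb : a <= sup S <= b.
  apply/andP; split; first exact: (ub_le_sup supS.2).
  by apply: ge_sup; [exists a | move=> t [/andP[]]].
have [h h0 Ph] := Ploc _ acb.
have h2 : 0 < h / 2 by rewrite divr_gt0.
have [t [/andP[at_ tb] Pat] hct] := sup_adherent h2 supS.
have tc : t <= sup S by apply: (ub_le_sup supS.2); split=> //; apply/andP.
pose r := Num.min b (sup S + h / 2).
have cr : sup S <= r.
  by rewrite le_min; case/andP: acb => _ ->; rewrite lerDl divr_ge0 // ltW.
have rb : r <= b by rewrite ge_min lexx.
have Par : P a r.
  apply: (Pcat a t r) => //; first exact: le_trans cr.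
  apply: Ph => //.
  have : r <= sup S + h / 2 by rewrite ge_min lexx orbT.
  lra.
have : r <= sup S.
  apply: (ub_le_sup supS.2); split=> //; rewrite rb andbT.
  exact: le_trans at_ (le_trans tc cr).
rewrite ge_min => /orP[bc|]; last lra.
by have <- : r = b by apply/eqP; rewrite eq_le rb (le_trans bc).
Qed.

(** First-order expansion, which unlike the difference quotient also makes
    sense at the point itself and can be compared across two increments. *)
Lemma is_deriveP (K : realType) (V : normedModType K) (w : K -> V) (t : K)
    (v : V) :
  is_derive t (1 : K) w v <->
  forall e, 0 < e -> \forall s \near t,
    `|w s - w t - (s - t) *: v| <= e * `|s - t|.
Proof.
split.
- case=> dw wv e e0.
  have : h^-1 *: ((w \o shift t) (h *: 1) - w t) @[h --> (0:K)^'] --> v.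
    by rewrite -wv; exact: dw.
  move=> /cvgrPdist_le /(_ e e0); rewrite near_withinE => H.
  have : \forall s \near t, (s - t != 0) ->
     `|v - (s - t)^-1 *: ((w \o shift t) ((s - t) *: 1) - w t)| <= e.
    have : s - t @[s --> t] --> (0 : K).
      by rewrite -[X in _ --> X](subrr t); apply: cvgB => //; apply: cvg_cst.
    by move=> /(_ _ H).
  apply: filterS => s; have [/eqP|st] := eqVneq (s - t) 0.
    rewrite subr_eq0 => /eqP -> _.
    by rewrite !subrr scale0r subr0 !normr0 mulr0.
  move=> /(_ isT) /=; rewrite scaler1 subrK => le_e.
  rewrite -[w s - w t](scalerKV st).
  rewrite -scalerBr normrZ mulrC ler_wpM2r //.
  by rewrite distrC.
- move=> H.
  suff cv : h^-1 *: ((w \o shift t) (h *: 1) - w t) @[h --> (0:K)^'] --> v.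
    by split; [exact: cvgP cv | exact: (cvg_lim (@norm_hausdorff _ _) cv)].
  apply/cvgrPdist_le => e e0; rewrite near_withinE.
  have : h + t @[h --> (0 : K)] --> t.
    by rewrite -[X in _ --> X]add0r; apply: cvgD; [exact: cvg_id | exact: cvg_cst].
  move=> /(_ _ (H e e0)) Ht.
  have : \forall h \near (0 : K),
    `|w (h + t) - w t - (h + t - t) *: v| <= e * `|h + t - t| by exact: Ht.
  apply: filterS => h /= + h0.
  rewrite addrK scaler1 => le_e.
  rewrite distrC -(ler_pM2l (x := `|h|)) ?normr_gt0 // -normrZ scalerBr.
  by rewrite scalerKV // mulrC.
Qed.

Section IntervalLists.
Context {K : realType}.
Implicit Types (s t r : K) (l : seq (K * K)) (O : set K).

(** The finite families of intervals over which absolute continuity is tested,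
    as lists ordered from left to right so that families on adjacent intervals
    can be concatenated. *)
Definition intervals_within O s r l : Prop :=
  [/\ all (fun p => [&& s <= p.1, p.1 <= p.2 & p.2 <= r]) l,
      pairwise (fun p p' => p.2 <= p'.1) l &
      forall p, p \in l -> `]p.1, p.2[%classic `<=` O].

Lemma intervals_within_cat O s t r l l' : s <= t -> t <= r ->
  intervals_within O s t l -> intervals_within O t r l' ->
  intervals_within O s r (l ++ l').
Proof.
move=> st tr [/allP bl dl Ol] [/allP bl' dl' Ol']; split.
- apply/allP => p; rewrite mem_cat => /orP[/bl|/bl'] /and3P[p1 p12 p2].
  + by rewrite p1 p12 (le_trans p2).
  + by rewrite (le_trans st p1) p12 p2.
- rewrite pairwise_cat dl dl' !andbT.
  apply/allrelP => p p' /bl/and3P[_ _ pt] /bl'/and3P[tp' _ _].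
  exact: le_trans pt tp'.
- by move=> p; rewrite mem_cat => /orP[/Ol|/Ol'].
Qed.

Lemma intervals_within_trivIset O s r l : intervals_within O s r l ->
  trivIset [set: 'I_(size l)]
    (fun i => `](tnth (in_tuple l) i).1, (tnth (in_tuple l) i).2[%classic).
Proof.
case=> _ /(pairwiseP (0, 0)) dl _.
apply/trivIsetP.
have key (i j : 'I_(size l)) : (i < j)%N ->
    (tnth (in_tuple l) i).2 <= (tnth (in_tuple l) j).1.
  move=> ij; rewrite !(tnth_nth (0, 0)) /=.
  by apply: dl => //; rewrite !inE.
move=> i j _ _ ij; rewrite -subset0 => x [/=].
rewrite !in_itv /= => /andP[ix xi] /andP[jx xj].
move: ij; rewrite -val_eqE neq_ltn => /orP[] /key; lra.
Qed.

Lemma intervals_within_size O s r l : open O -> intervals_within O s r l ->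
  ((\sum_(i < size l) ((tnth (in_tuple l) i).2 - (tnth (in_tuple l) i).1))%:E
   <= lebesgue_measure O)%E.
Proof.
move=> oO lP; have [/allP bl _ Ol] := lP.
pose F (i : 'I_(size l)) : set K :=
  `](tnth (in_tuple l) i).1, (tnth (in_tuple l) i).2[%classic.
have mF i : measurable (F i) by exact: measurable_itv.
have mU : measurable (\big[setU/set0]_(i < size l) F i).
  by apply: bigsetU_measurable => i _.
apply: (@le_trans _ _ (lebesgue_measure (\big[setU/set0]_(i < size l) F i))).
- rewrite measure_semi_additive_ord //; last exact: intervals_within_trivIset lP.
  rewrite -sumEFin; apply: lee_sum => i _.
  have /bl/and3P[_ le12 _] := mem_tnth i (in_tuple l).
  have := lebesgue_measure_itv
    `](tnth (in_tuple l) i).1, (tnth (in_tuple l) i).2[.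
  rewrite /F /= lte_fin => ->.
  case: ltP => [//|ge12].
  by rewrite lee_fin subr_le0.
- apply: le_measure; rewrite ?inE //; first exact: measurable_realfun.open_measurable.
  apply: (big_ind (fun A => A `<=` O)) => [x []|A B AO BO x [/AO|/BO]|i _] //.
  exact/Ol/mem_tnth.
Qed.

End IntervalLists.

Section MeanValue.
Context {K : realType} {V : normedModType K}.
Implicit Types (w : K -> V) (v : V) (a b e d : K).

(** Absolute continuity, restated for lists of intervals inside an open set of
    small measure. *)
Lemma absolutely_continuous_on_intervals w a b O e d l :
  open O -> (lebesgue_measure O < d%:E)%E ->
  (forall (n : nat) (s t : 'I_n -> K),
      (forall i, [/\ a <= s i, s i <= t i & t i <= b]) ->
      trivIset setT (fun i => `]s i, t i[%classic) ->
      \sum_(i < n) (t i - s i) < d ->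
      \sum_(i < n) `|w (t i) - w (s i)| < e) ->
  intervals_within O a b l ->
  \sum_(p <- l) (p.2 - p.1) < d /\ \sum_(p <- l) `|w p.2 - w p.1| < e.
Proof.
move=> oO muO acw lP; have [/allP bl _ _] := lP.
rewrite (big_tnth _ _ l) [X in _ /\ X < _](big_tnth _ _ l).
have len : \sum_(i < size l)
    ((tnth (in_tuple l) i).2 - (tnth (in_tuple l) i).1) < d.
  by rewrite -lte_fin; apply: le_lt_trans muO; exact: intervals_within_size lP.
split=> //.
apply: (acw (size l) (fun i => (tnth (in_tuple l) i).1)
                     (fun i => (tnth (in_tuple l) i).2)) len.
- by move=> i; have /bl/and3P[] := mem_tnth i (in_tuple l).
- exact: intervals_within_trivIset lP.
Qed.

(** Cover the exceptional null set by an open set [W] of small measure. Around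
    an exceptional time a short interval lies in [W], and the increment of [w]
    over it is simply recorded in a list; around any other time the derivative
    controls the increment. Cousin's lemma glues these local estimates, and
    absolute continuity makes the recorded increments negligible. *)
Lemma mean_value_absolutely_continuous w a b v e :
  a <= b -> 0 <= e -> absolutely_continuous_on w a b ->
  {ae lebesgue_measure, forall t : K, a <= t <= b ->
     exists2 v', is_derive t (1 : K) w v' & `|v' - v| <= e} ->
  `|w b - w a - (b - a) *: v| <= e * (b - a).
Proof.
move=> ab e0 acw [N [mN muN0 subN]].
suff H eta : 0 < eta ->
    `|w b - w a - (b - a) *: v| <= (e + eta) * (b - a) + eta.
  apply/ler_addgt0Pr => eta eta0.
  have c0 : 0 < 1 + (b - a) by rewrite ltr_wpDr // subr_ge0.
  have := H _ (divr_gt0 eta0 c0).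
  suff -> : (e + eta / (1 + (b - a))) * (b - a) + eta / (1 + (b - a))
    = e * (b - a) + eta by [].
  by field; rewrite gt_eqF.
move=> eta0.
(* Half of [eta] pays for the increments of [w] over the recorded intervals,
   the other half for those of the linear function [x *: v]. *)
have [d d0 acd] := acw (eta / 2) (divr_gt0 eta0 (ltr0Sn _ 1)).
have nv0 : 0 < `|v| + 1 by rewrite ltr_wpDl.
pose d' := Num.min d (eta / 2 / (`|v| + 1)).
have d'0 : 0 < d' by rewrite lt_min d0 !divr_gt0.
have Nfin : (lebesgue_measure N < +oo)%E by rewrite [X in (X < _)%E]muN0.
have [W [oW NW muNW]] := lebesgue_regularity_outer mN Nfin d'0.
have mW := measurable_realfun.open_measurable oW.
have muW : (lebesgue_measure W < d'%:E)%E.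
  apply: le_lt_trans muNW; rewrite -[X in lebesgue_measure X](setDUK NW).
  have mD : measurable (W `\` N) by exact: measurableD.
  by apply: le_trans (measureU2 lebesgue_measure mN mD) _; rewrite [X in (X + _)%E]muN0 add0e.
pose P s r := exists2 l, intervals_within W s r l &
  `|w r - w s - (r - s) *: v| <= (e + eta) * (r - s) +
    \sum_(p <- l) (`|w p.2 - w p.1| + `|v| * (p.2 - p.1)).
(* The increments to be estimated are those of [g], hence additive. *)
pose g x := w x - x *: v.
have gE x y : w x - w y - (x - y) *: v = g x - g y.
  by rewrite scalerBl !opprB addrACA [RHS]addrACA; congr (_ + _); rewrite addrC.
have : P a b.
  apply: cousin ab _ _ => [s t r st tr [l lP le1] [l' lP' le2]|t tab].
  - exists (l ++ l'); first exact: intervals_within_cat st tr lP lP'.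
    rewrite big_cat /=.
    have -> : w r - w s - (r - s) *: v =
        (w r - w t - (r - t) *: v) + (w t - w s - (t - s) *: v).
      by rewrite !gE addrA subrK.
    apply: le_trans (ler_normD _ _) _.
    by apply: le_trans (lerD le2 le1) _; rewrite le_eqVlt; apply/orP; left;
      apply/eqP; ring.
  - have [Nt|Nt] := pselect (N t).
    + have /nbhs_ballP[h /= h0 hW] := oW _ (NW _ Nt).
      exists h => // s r as_ st tr rb rs.
      exists [:: (s, r)].
        split=> //=; first by rewrite !lexx (le_trans st).
        move=> p; rewrite inE => /eqP -> /= x; rewrite /= in_itv /= => /andP[sx xr].
        by apply: hW; rewrite /ball /= ltr_norml; apply/andP; split; lra.
      rewrite big_seq1 /=.
      have rs0 : 0 <= r - s by rewrite subr_ge0 (le_trans st).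
      apply: le_trans (ler_normB _ _) _.
      rewrite normrZ (ger0_norm rs0) [_ * `|v|]mulrC.
      by rewrite lerDr mulr_ge0 // addr_ge0 // ltW.
    + have [v' dw v'v] : exists2 v', is_derive t (1 : K) w v' & `|v' - v| <= e.
        by apply: contrapT => H; apply: Nt; apply: subN => /(_ tab).
      have /nbhs_ballP[h /= h0 hw] := (is_deriveP _ _ w t v').1 dw eta eta0.
      exists h => // s r as_ st tr rb rs; exists [::] => //.
      rewrite big_nil addr0.
      have nearE x : `|x - t| < h ->
          `|w x - w t - (x - t) *: v| <= (e + eta) * `|x - t|.
        move=> xt; have := hw x.
        rewrite /ball /= distrC => /(_ xt) H.
        have -> : w x - w t - (x - t) *: v =
            (w x - w t - (x - t) *: v') + (x - t) *: (v' - v).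
          by rewrite scalerBr addrA subrK.
        rewrite [e + eta]addrC mulrDl.
        apply: le_trans (ler_normD _ _) _; apply: lerD => //.
        by rewrite normrZ mulrC ler_wpM2r.
      have -> : w r - w s - (r - s) *: v =
          (w r - w t - (r - t) *: v) - (w s - w t - (s - t) *: v).
        by rewrite !gE [- (_ - g t)]opprB addrA subrK.
      apply: le_trans (ler_normB _ _) _.
      have := nearE s; have := nearE r.
      rewrite ger0_norm ?subr_ge0 // => /(_ _)H1.
      rewrite ler0_norm ?subr_le0 // => /(_ _)H2.
      apply: le_trans (lerD (H1 _) (H2 _)) _; lra.
have d'd : d' <= d by rewrite ge_min lexx.
case=> l lP le1.
have [len sw] : _ /\ _ :=
  absolutely_continuous_on_intervals _ _ _ _ _ _ _ oW muW
  (fun n s t h1 h2 h3 => acd n s t h1 h2 (lt_le_trans h3 d'd)) lP.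
apply: le_trans le1 _; rewrite lerD2l big_split /= -mulr_sumr.
suff : `|v| * \sum_(p <- l) (p.2 - p.1) <= eta / 2 by lra.
apply: (@le_trans _ _ ((`|v| + 1) * d')).
  apply: ler_pM; rewrite ?lerDl ?normr_ge0 //; last exact: ltW.
  have [/allP lab _ _] := lP; rewrite big_seq; apply: sumr_ge0 => p.
  by move=> /lab/and3P[_ ? _]; rewrite subr_ge0.
by rewrite mulrC -ler_pdivlMr // ge_min lexx orbT.
Qed.

End MeanValue.

Section AbsolutelyContinuous.
Context {K : realType} {V : normedModType K}.
Implicit Types (w phi : K -> V) (a b c d t : K).

Lemma absolutely_continuous_on_sub w a b c d : a <= c -> d <= b ->
  absolutely_continuous_on w a b -> absolutely_continuous_on w c d.
Proof.
move=> ac db acw e e0; have [h h0 H] := acw e e0.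
exists h => // n s t st; apply: H => i; have [cs -> td] := st i.
by split=> //; [exact: le_trans cs|exact: le_trans db].
Qed.

Lemma absolutely_continuous_on_continuous w a b :
  absolutely_continuous_on w a b -> {within `[a, b], continuous w}.
Proof.
move=> acw; apply/subspace_continuousP => x.
rewrite /= in_itv /= => /andP[ax xb].
apply/cvgrPdist_lt => e e0; have [h h0 H] := acw e e0.
rewrite near_withinE; apply/nbhs_ballP; exists h => //= y.
rewrite /ball /= => xy; rewrite in_itv /= => /andP[ay yb].
have key s t : a <= s -> s <= t -> t <= b -> t - s < h -> `|w t - w s| < e.
  move=> as_ st tb ts.
  have := H 1%N (fun=> s) (fun=> t); rewrite !big_ord1; apply=> //.
  by move=> i j _ _ _; rewrite !ord1.
have [le_xy|/ltW le_yx] := leP x y.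
- by rewrite distrC key // -[y - x]ger0_norm ?subr_ge0 // distrC.
- by rewrite key // -[x - y]ger0_norm ?subr_ge0.
Qed.

(** Near [t] the derivative is almost everywhere close to [phi t], so by the
    mean value inequality the increments of [w] from [t] are close to those of
    the linear map with slope [phi t]. *)
Lemma is_derive_absolutely_continuous w phi a b t :
  absolutely_continuous_on w a b ->
  {ae lebesgue_measure, forall s : K, a <= s <= b ->
     is_derive s (1 : K) w (phi s)} ->
  a < t < b -> {for t, continuous phi} -> is_derive t (1 : K) w (phi t).
Proof.
move=> acw dw /andP[at_ tb] cphi.
apply/is_deriveP => e e0.
have /cvgrPdist_le /(_ e e0) /nbhs_ballP[h /= h0 hphi] := cphi.
have key c d : a <= c -> c <= d -> d <= b ->
    (forall s, c <= s <= d -> `|t - s| < h) ->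
    `|w d - w c - (d - c) *: phi t| <= e * (d - c).
  move=> ac cd db near_t; apply: mean_value_absolutely_continuous => //.
  - exact: ltW.
  - exact: absolutely_continuous_on_sub acw.
  have [N [mN muN subN]] := dw; exists N; split=> // s ncd; apply: subN => dws.
  apply: ncd => /andP[cs sd]; exists (phi s).
    by apply: dws; rewrite (le_trans ac) // (le_trans sd).
  by rewrite distrC; apply: hphi; apply: near_t; rewrite cs.
have : \forall s \near t, [/\ a < s, s < b & `|t - s| < h].
  near=> s; split; near: s.
  - exact: lt_nbhsr.
  - exact: lt_nbhsl.
  - exact: nbhsx_ballx.
apply: filterS => s [as_ sb sth].
have [ts|/ltW st] := leP t s.
- rewrite (ger0_norm (x := s - t)) ?subr_ge0 //; apply: key; rewrite ?(ltW at_) ?(ltW sb) //.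
  move=> r /andP[tr rs]; apply: le_lt_trans sth.
  by rewrite distrC [X in _ <= X]distrC !ger0_norm ?subr_ge0 ?lerD2r.
- rewrite (distrC s) (ger0_norm (x := t - s)) ?subr_ge0 //.
  have -> : w s - w t - (s - t) *: phi t = - (w t - w s - (t - s) *: phi t).
    by rewrite -[s - t]opprB scaleNr -[w s - w t]opprB -opprD.
  rewrite normrN; apply: key; rewrite ?(ltW as_) ?(ltW tb) //.
  move=> r /andP[sr rt]; apply: le_lt_trans sth.
  by rewrite !ger0_norm ?subr_ge0 // lerD2l lerN2.
Unshelve. all: by end_near.
Qed.

End AbsolutelyContinuous.

(** The function [expR (c * t) * u t] is nonincreasing. *)
Lemma exponential_decay (K : realType) (u : K -> K) (a b c : K) :
  a <= b -> {within `[a, b], continuous u} ->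
  (forall t, a < t < b ->
     exists2 u', is_derive t (1 : K) u u' & u' <= - c * u t) ->
  u b <= expR (- c * (b - a)) * u a.
Proof.
move=> ab cu du.
pose v t := expR (c * t) * u t.
suff : v b <= v a.
  rewrite /v mulrC -ler_pdivlMr ?expR_gt0 // -expRN => /le_trans; apply.
  rewrite mulrAC -expRD le_eqVlt; apply/orP; left; apply/eqP.
  by congr (expR _ * _); ring.
have dexp t : is_derive t (1 : K) (expR \o *%R c) (expR (c * t) * c).
  apply: is_derive1_comp.
  have := is_deriveZ c (is_derive_id t (1 : K)).
  by rewrite /GRing.scale /= mulr1.
have dv t : a < t < b ->
    exists2 v', is_derive t (1 : K) v v' & v' <= 0.
  move=> /du[u' du' le_u']; have := is_deriveM (dexp t) du'.
  move=> dv; eexists; first exact: dv.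
  rewrite /= /GRing.scale /=.
  have -> : expR (c * t) * u' + u t * (expR (c * t) * c) =
    expR (c * t) * (u' - - c * u t) by ring.
  by rewrite mulr_ge0_le0 ?expR_ge0 // subr_le0.
apply: (ler0_derive1_le_cc (a := a) (b := b)).
- by move=> t; rewrite in_itv /= => /dv[v' [dv' _] _].
- by move=> t; rewrite in_itv /= => /dv[v' [_ dv'] v'0]; rewrite derive1E dv'.
- apply/subspace_continuousP => t tab; apply: cvgM.
    apply: cvg_within_filter.
    suff : {for t, continuous (expR \o *%R c)} by [].
    apply: differentiable_continuous; apply/derivable1_diffP.
    by have [] := dexp t.
  exact: (subspace_continuousP _ _).1 cu t tab.
- by rewrite in_itv /= lexx ab.
- by rewrite in_itv /= lexx ab.
- by [].
Qed.

(** * Gradients on the rotation group *)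

Section Gradient.
Context {K : realType}.
Implicit Types (R A G xi : 'M[K]_3) (f : 'M[K]_3 -> K) (k : K).

Lemma hat_psi_so3 A k : so3 A -> hat (- (k *: psi A)) = - k *: A.
Proof.
move=> hA; have hA' : A^T = - A by [].
have -> : - (k *: psi A) = vex (- k *: A).
  have -> : psi A = vex A.
    rewrite /psi hA' opprK; have -> : A + A = (2 : K) *: A.
      by rewrite scaler_nat mulr2n.
    by rewrite scalerA mulVf ?pnatr_eq0 // scale1r.
  by apply/matrixP => i j; rewrite !mxE mulNr.
by apply: hatK; rewrite /so3 /= linearZ /= hA' scalerN.
Qed.

Lemma SO3_trmx_mul R : SO3 R -> R^T *m R = 1%:M.
Proof. by case=> _ /mulmx1C. Qed.

Lemma tangent_scale R xi k : tangent R xi -> tangent R (k *: xi).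
Proof.
case=> A hA <-; exists (k *: A); last by rewrite -scalemxAr.
by rewrite /so3 /= linearZ /= (_ : A^T = - A) // scalerN.
Qed.

(** The feedback turns the left-trivialized gradient into a descent direction:
    the closed loop is a gradient flow. *)
Lemma tangent_feedback R G k : SO3 R -> tangent R G ->
  R *m hat (- (k *: psi (R^T *m G))) = - k *: G.
Proof.
move=> hR [A hA <-]; rewrite mulmxA SO3_trmx_mul // mul1mx hat_psi_so3 //.
by rewrite -scalemxAr.
Qed.

Lemma frobenius_sqr G : frobenius G ^+ 2 = \tr (G^T *m G).
Proof.
rewrite sqr_sqrtr // sumr_ge0 // => i _; rewrite mxE sumr_ge0 // => j _.
by rewrite mxE -expr2 sqr_ge0.
Qed.

Lemma metric_self R G k : SO3 R ->
  metric R G (k *: G) = k * frobenius G ^+ 2.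
Proof.
case=> _ RRT; rewrite frobenius_sqr /metric -!scalemxAr linearZ /=.
by rewrite trmx_mul trmxK -mulmxA (mulmxA R) RRT mul1mx.
Qed.

(** Chain rule on [SO3]. The extension witnessing the gradient at [R t] agrees
    with [f] along the curve near [t], so it may replace [f] there. *)
Lemma is_derive_along_curve f (R : K -> 'M[K]_3) t G xi :
  (\forall s \near t, SO3 (R s)) -> is_gradient f (R t) G ->
  is_derive t (1 : K) R xi -> tangent (R t) xi ->
  is_derive t (1 : K) (f \o R) (metric (R t) G xi).
Proof.
move=> SO3R [_ [F [Ff dF gradF]]] dR Txi.
have diffR : differentiable R t by apply/derivable1_diffP; case: dR.
have nearF : \forall s \near t, (F \o R) s = (f \o R) s.
  have cR : R s @[s --> t] --> R t by exact: differentiable_continuous.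
  have := cR _ Ff => Ff'.
  have : \forall s \near t, SO3 (R s) -> F (R s) = f (R s) by exact: Ff'.
  by apply: filterS2 SO3R => s SR /(_ SR).
have diffFR : differentiable (F \o R) t by exact: differentiable_comp.
apply: (near_eq_is_derive nearF).
split; first exact/derivable1_diffP.
rewrite deriveE // diff_comp //= -gradF //; congr ('d F (R t) _).
by rewrite -deriveE //; case: dR.
Qed.

End Gradient.

(** * Decay of the potential during flows *)

Lemma continuous_within_interior (K : realType) (T : topologicalType)
    (w : K -> T) (a b t : K) :
  {within `[a, b], continuous w} -> a < t < b -> {for t, continuous w}.
Proof.
move=> /subspace_continuousP cw /andP[at_ tb] B wB.
have tab : `[a, b]%classic t by rewrite /= in_itv /= !ltW.
have H : \forall s \near t, `[a, b]%classic s -> B (w s) := cw t tab B wB.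
have : \forall s \near t, a < s /\ s < b.
  by near=> s; split; near: s; [exact: lt_nbhsr|exact: lt_nbhsl].
apply: filterS2 H => s Bs [as_ sb]; apply: Bs.
by rewrite /= in_itv /= !ltW.
Unshelve. all: by end_near.
Qed.

Section Flow.
Context {K : realType} (Q : set nat) (U : state K -> K).
Context (Dom : set (state K)) (delta kc : K).

Lemma grad_is_gradient R q : continuously_differentiable_on U Dom ->
  Dom (R, q) -> is_gradient (fun S => U (S, q)) R (grad U (R, q)).
Proof. by move=> [exG _] /exG; exact: xgetPex. Qed.

Lemma closed_loop_flow_grad R q : SO3 R ->
  is_gradient (fun S => U (S, q)) R (grad U (R, q)) ->
  closed_loop_flow U kc (R, q) = - kc *: grad U (R, q).
Proof. by move=> SR [TG _]; exact: tangent_feedback. Qed.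

(** Interior times of a flow interval lie in the flow set, hence in [Dom],
    where the gradient is continuous; this upgrades the almost everywhere
    differential equation to every interior time, where [U] then decreases at
    rate [kc * frobenius (grad U) ^+ 2 >= kc * a3 / a2 * U]. At the end points
    only the continuity of [U] is available. *)
Lemma flow_decay (a2 a3 : K) (R : K -> 'M[K]_3) (q : nat) (a b : K) :
  0 < kc -> 0 < a2 -> 0 < a3 ->
  potential_function Q U Dom ->
  flow_set Q U delta `<=` Dom ->
  (forall x, (SO3 `*` Q) x -> U x <= a2 * dist_I x.1 ^+ 2) ->
  (forall x, flow_set Q U delta x ->
     a3 * dist_I x.1 ^+ 2 <= frobenius (grad U x) ^+ 2) ->
  a <= b -> Q q ->
  (forall t, a <= t <= b -> SO3 (R t)) ->
  (forall t, a < t < b -> flow_set Q U delta (R t, q)) ->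
  absolutely_continuous_on R a b ->
  {ae lebesgue_measure, forall t : K, a <= t <= b ->
     is_derive t (1 : K) R (closed_loop_flow U kc (R t, q))} ->
  U (R b, q) <= expR (- (kc * a3 / a2) * (b - a)) * U (R a, q).
Proof.
move=> kc0 a20 a30 [cU _ _ _ C1U] CD leU leG ab Qq SR CR acR dR.
have cR := absolutely_continuous_on_continuous _ _ _ acR.
have near_ab t : a < t < b -> \forall s \near t, a < s < b.
  move=> /andP[at_ tb]; near=> s; apply/andP; split; near: s.
  - exact: lt_nbhsr.
  - exact: lt_nbhsl.
have ltW_ab t : a < t < b -> a <= t <= b.
  by move=> /andP[at_ tb]; rewrite !ltW.
have gradR t : a < t < b ->
    is_gradient (fun S => U (S, q)) (R t) (grad U (R t, q)).
  by move=> /CR/CD; exact: grad_is_gradient.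
have flowE t : a < t < b ->
    closed_loop_flow U kc (R t, q) = - kc *: grad U (R t, q).
  by move=> tab; apply: closed_loop_flow_grad; [exact/SR/ltW_ab|exact: gradR].
have cgrad t : a < t < b -> {for t, continuous (fun s => grad U (R s, q))}.
  move=> tab B GB.
  have DRt : Dom (R t, q) by exact/CD/CR.
  have H : \forall S \near R t, Dom (S, q) -> B (grad U (S, q)) :=
    (subspace_continuousP _ _).1 (C1U.2 q) (R t) DRt B GB.
  have : \forall s \near t, Dom (R s, q) -> B (grad U (R s, q)) :=
    continuous_within_interior _ _ _ _ _ _ cR tab _ H.
  by apply: filterS2 (near_ab t tab) => s /CR/CD DRs; exact.
have cflow t : a < t < b ->
    {for t, continuous (fun s => closed_loop_flow U kc (R s, q))}.
  move=> tab; rewrite /prop_for /continuous_at flowE //.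
  apply: cvg_trans (cvgZl_tmp (k := - kc) (cgrad t tab)).
  by apply: near_eq_cvg; apply: filterS (near_ab t tab) => s /flowE ->.
have dR' t : a < t < b -> is_derive t (1 : K) R (- kc *: grad U (R t, q)).
  move=> tab; rewrite -flowE //.
  exact: (is_derive_absolutely_continuous R
    (fun s => closed_loop_flow U kc (R s, q)) a b t acR dR tab (cflow t tab)).
apply: (exponential_decay _ (fun t => U (R t, q))) => //.
  apply/subspace_continuousP => t tab B UB.
  have SQ : (SO3 `*` Q) (R t, q).
    by split=> //; apply: SR; rewrite /= in_itv in tab.
  have H : \forall x \near (R t, q), (SO3 `*` Q) x -> B (U x) :=
    (subspace_continuousP _ _).1 cU (R t, q) SQ B UB.
  have : (R s, q) @[s --> within `[a, b] (nbhs t)] --> (R t, q).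
    have cRt := (subspace_continuousP _ _).1 cR t tab.
    exact: (cvg_pair cRt (cvg_cst q)).
  move=> /(_ _ H) H'.
  have {H'} : \forall s \near t, `[a, b]%classic s ->
      (SO3 `*` Q) (R s, q) -> B (U (R s, q)) := H'.
  apply: filterS => s + sab; apply=> //; split=> //.
  by apply: SR; rewrite /= in_itv in sab.
move=> t tab; have := dR' t tab.
have SRt := SR t (ltW_ab t tab).
have [TG _] := gradR t tab.
move=> /(is_derive_along_curve (fun S => U (S, q)) R t (grad U (R t, q))) du.
exists (metric (R t) (grad U (R t, q)) (- kc *: grad U (R t, q))).
  apply: du => //; last exact: tangent_scale.
    by apply: filterS (near_ab t tab) => s /ltW_ab/SR.
  exact: gradR.
rewrite metric_self // !mulNr lerN2 -!mulrA ler_pM2l //.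
apply: le_trans (leG _ (CR t tab)).
rewrite ler_pM2l //= ler_pdivrMl //.
exact: (leU (R t, q)).
Unshelve. all: by end_near.
Qed.

End Flow.

(** * Decay along hybrid solutions *)

Section Hybrid.
Context {K : realType}.

(** Induction along a hybrid time domain: below a given hybrid time the domain
    is a finite staircase, climbed by alternating flows and jumps. *)
Lemma hybrid_time_domain_ind (E : set (K * nat)) (P : K -> nat -> Prop) :
  hybrid_time_domain E -> P 0 0%N ->
  (forall a b j, a <= b -> `[a, b] `<=` slice E j -> P a j -> P b j) ->
  (forall t j, E (t, j) -> E (t, j.+1) -> P t j -> P t j.+1) ->
  forall t j, E (t, j) -> P t j.
Proof.
move=> [_ hE] P0 Pflow Pjump t j Etj.
have [J [tau [tau0 tau_le EE]]] := hE t j Etj.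
have mem k s : (k < J)%N -> tau k <= s <= tau k.+1 -> E (s, k).
  move=> kJ ks; suff [] : (E `&` [set p | p.1 <= t /\ (p.2 <= j)%N]) (s, k) by [].
  by rewrite EE; exists k => //; split; rewrite //= in_itv.
have flow k s : (k < J)%N -> tau k <= s <= tau k.+1 -> P (tau k) k -> P s k.
  move=> kJ /andP[ks sk]; apply: Pflow => // r.
  rewrite /= in_itv /= => /andP[kr rs]; apply: mem => //.
  by rewrite kr (le_trans rs).
(* The left end [tau k] of each step is reached first. *)
have Ptau k : (k < J)%N -> P (tau k) k.
  elim: k => [_|k IHk kJ]; first by rewrite tau0.
  have kJ' := ltnW kJ.
  apply: Pjump; [apply: mem|apply: mem|apply: flow (IHk kJ')] => //.
  - by rewrite lexx tau_le.
  - by rewrite lexx tau_le.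
  - by rewrite lexx tau_le.
have : (E `&` [set p | p.1 <= t /\ (p.2 <= j)%N]) (t, j) by [].
rewrite EE => -[k kJ [/= + kj]]; rewrite in_itv /= => tk.
by rewrite kj in tk *; exact/flow/Ptau.
Qed.

(** The mode is constant during a flow, by the mean value inequality with a
    zero derivative. *)
Lemma discrete_flow_constant (n : K -> nat) (a b : K) : a <= b ->
  absolutely_continuous_on (fun t => (n t)%:R : K) a b ->
  {ae lebesgue_measure, forall t : K, a <= t <= b ->
     is_derive t (1 : K) (fun s => (n s)%:R : K) 0} ->
  n b = n a.
Proof.
move=> ab acn dn.
have := mean_value_absolutely_continuous _ a b 0 0 ab (lexx 0) acn.
rewrite scaler0 subr0 mul0r normr_le0 subr_eq0 eqr_nat => H; apply/eqP/H.
have [N [mN muN subN]] := dn; exists N; split=> // s ncd; apply: subN => dns.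
by apply: ncd => sab; exists 0; [exact: dns|rewrite subrr normr0].
Qed.

Lemma jump_decrease (Q : set nat) (U : state K -> K) (delta : K) x y :
  jump_set Q U delta x -> closed_loop_jump Q U x y -> U y <= U x - delta.
Proof.
case: x y => [R q] [S m] [_ /= gap] [/= -> [Qm minm]].
suff : U (R, m) <= minU Q U R by lra.
by apply: lb_le_inf; [exists (U (R, m)), m|move=> _ [p Qp <-]; exact: minm].
Qed.

(** With the mode frozen at its initial value, a flow piece of a hybrid
    solution is a curve of rotations to which [flow_decay] applies. *)
Lemma solution_flow_decay (Q : set nat) (U : state K -> K)
    (Dom : set (state K)) (delta kc a2 a3 : K) E x j (a b : K) :
  0 < kc -> 0 < a2 -> 0 < a3 ->
  potential_function Q U Dom ->
  flow_set Q U delta `<=` Dom ->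
  (forall x, (SO3 `*` Q) x -> U x <= a2 * dist_I x.1 ^+ 2) ->
  (forall x, flow_set Q U delta x ->
     a3 * dist_I x.1 ^+ 2 <= frobenius (grad U x) ^+ 2) ->
  hybrid_solution (SO3 `*` Q)
    (flow_set Q U delta) (closed_loop_flow U kc)
    (jump_set Q U delta) (closed_loop_jump Q U) E x ->
  a <= b -> `[a, b] `<=` slice E j ->
  U (x (b, j)) <= expR (- (kc * a3 / a2) * (b - a)) * U (x (a, j)).
Proof.
move=> kc0 a20 a30 hU CD leU leG [[[htd acx] EX] _ flowC dx _] ab abE.
have {}abE t : a <= t <= b -> E (t, j) by move=> tab; apply: abE; rewrite /= in_itv.
have abE' : `[a, b] `<=` slice E j.
  by move=> t; rewrite /= in_itv; exact: abE.
have [acR acq] := acx j.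
have qconst t : a <= t <= b -> (x (t, j)).2 = (x (a, j)).2.
  move=> /andP[at_ tb].
  apply: (discrete_flow_constant (fun s => (x (s, j)).2)) => //.
    by apply: absolutely_continuous_on_sub (acq a b ab abE').
  have [N [mN muN subN]] := dx j; exists N; split=> // s nds; apply: subN => ds.
  apply: nds => /andP[as_ st]; apply: (ds _).2; apply: abE.
  by rewrite as_ (le_trans st).
have xE t : a <= t <= b -> x (t, j) = ((x (t, j)).1, (x (a, j)).2).
  by move=> /qconst <-; case: (x (t, j)).
have aab : a <= a <= b by rewrite lexx.
have abb : a <= b <= b by rewrite lexx ab.
rewrite (xE b abb) (xE a aab) /=.
apply: (flow_decay Q U Dom delta kc a2 a3 (fun t => (x (t, j)).1)) => //.
- by have [] := EX _ (abE a aab).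
- by move=> t /abE/EX[].
- move=> t /andP[at_ tb]; rewrite -xE ?ltW //; apply: flowC.
  have : \forall s \near t, s \in `]a, b[.
    by apply: near_in_itvoo; rewrite in_itv /= at_.
  apply: filterS => s; rewrite in_itv /= => /andP[as_ sb]; apply: abE.
  by rewrite !ltW.
- exact: acR abE'.
- have [N [mN muN subN]] := dx j; exists N; split=> // s nds; apply: subN => ds.
  by apply: nds => sab; rewrite -xE //; exact: (ds (abE s sab)).1.
Qed.

End Hybrid.

Theorem theorem1 (K : realType) (Q : set nat) (hQ : finite_set Q)
    (Dom : set (state K)) (hDom : Dom `<=` SO3 `*` Q)
    (delta kc : K) (hdelta : 0 < delta) (hkc : 0 < kc)
    (U : state K -> K) (hU : potential_function Q U Dom)
    (hsyn : exp_synergistic Q U Dom delta) :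
  globally_exponentially_stable (fun x : state K => dist_I x.1)
    (hybrid_solution (SO3 `*` Q)
       (flow_set Q U delta) (closed_loop_flow U kc)
       (jump_set Q U delta) (closed_loop_jump Q U)).
Proof.
have [a1 [a2 [a3 [a4 [[a10 a20 a30 _] quadU quadG CD]]]]] := hsyn.
have leU x : (SO3 `*` Q) x -> U x <= a2 * dist_I x.1 ^+ 2.
  by move=> /quadU/andP[].
have geU x : (SO3 `*` Q) x -> a1 * dist_I x.1 ^+ 2 <= U x.
  by move=> /quadU/andP[].
have leG x : flow_set Q U delta x ->
    a3 * dist_I x.1 ^+ 2 <= frobenius (grad U x) ^+ 2.
  by move=> /quadG/andP[].
have [_ U0 _ _ _] := hU.
move=> r r0.
pose c := kc * a3 / a2; pose M := a2 * r ^+ 2; pose mu := delta / M.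
have c0 : 0 < c by rewrite divr_gt0 // mulr_gt0.
have M0 : 0 < M by rewrite mulr_gt0 // exprn_gt0.
have mu0 : 0 < mu by rewrite divr_gt0.
pose lam := Num.min c mu / 2.
have lam0 : 0 < lam by rewrite divr_gt0 // lt_min c0.
exists (Num.sqrt (a2 / a1)), lam; split=> //.
  by rewrite sqrtr_gt0 divr_gt0.
move=> E x solx xr t j Etj.
have [[[htd _] EX] [E00 _] _ _ jumpx] := solx.
have Ux00 : U (x (0, 0%N)) <= M.
  apply: le_trans (leU _ (EX _ E00)) _; rewrite ler_pM2l //.
  by rewrite ler_sqr // nnegrE ?sqrtr_ge0 // ltW.
have decay : U (x (t, j)) <= expR (- (c * t + mu * j%:R)) * U (x (0, 0%N)).
  suff [] : E (t, j) /\
    U (x (t, j)) <= expR (- (c * t + mu * j%:R)) * U (x (0, 0%N)) by [].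
  apply: (hybrid_time_domain_ind E (fun t j => E (t, j) /\
    U (x (t, j)) <= expR (- (c * t + mu * j%:R)) * U (x (0, 0%N))) htd)
    => //.
  - by split=> //; rewrite !mulr0 addr0 oppr0 expR0 mul1r.
  - move=> a b k ab abE [_ IH]; split.
      by apply: abE; rewrite /= in_itv /= lexx ab.
    apply: le_trans (solution_flow_decay Q U Dom delta kc a2 a3 E x k a b
      hkc a20 a30 hU CD leU leG solx ab abE) _.
    rewrite -/c.
    apply: le_trans (ler_wpM2l (expR_ge0 _) IH) _.
    rewrite mulrA -expRD le_eqVlt; apply/orP; left; apply/eqP.
    by congr (expR _ * _); ring.
  - move=> s k Esk Esk1 [_ IH]; split=> //.
    have [Dx gx] := jumpx s k Esk Esk1.
    (* The bound on [U] that converts the gap [delta] into a factor. *)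
    have UskM : U (x (s, k)) <= M.
      apply: le_trans IH (le_trans _ Ux00).
      rewrite ler_piMl //; first exact: U0 _ (EX _ E00).
      have s0 : 0 <= s := htd.1 _ Esk.
      rewrite -expR0 ler_expR oppr_le0.
      by rewrite addr_ge0 // mulr_ge0 ?ler0n // ltW.
    apply: le_trans (jump_decrease Q U delta _ _ Dx gx) _.
    have -> : expR (- (c * s + mu * k.+1%:R)) * U (x (0, 0%N)) =
        expR (- mu) * (expR (- (c * s + mu * k%:R)) * U (x (0, 0%N))).
      by rewrite mulrA -expRD -natr1; congr (expR _ * _); ring.
    apply: le_trans (ler_wpM2l (expR_ge0 _) IH).
    apply: (@le_trans _ _ ((1 - mu) * U (x (s, k)))).
      rewrite mulrBl mul1r lerD2l lerN2 /mu mulrAC ler_pdivrMr //.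
      by rewrite ler_pM2l.
    by rewrite ler_wpM2r ?(U0 _ (EX _ Esk)) // expR_ge1Dx.
have t0 : 0 <= t := htd.1 _ Etj.
(* The potential is quadratic in the distance, so squares are compared. *)
rewrite -ler_sqr ?nnegrE ?mulr_ge0 ?sqrtr_ge0 ?expR_ge0 //.
have a12 : 0 <= a2 / a1 by rewrite divr_ge0 // ltW.
rewrite !exprMn (sqr_sqrtr a12) -expRM_natl.
rewrite -(ler_pM2l a10); apply: le_trans (geU _ (EX _ Etj)) _.
apply: le_trans decay _.
have -> : a1 * (a2 / a1 * expR (2%:R * (- lam * (t + j%:R))) *
    dist_I (x (0, 0%N)).1 ^+ 2) = expR (2%:R * (- lam * (t + j%:R))) *
    (a2 * dist_I (x (0, 0%N)).1 ^+ 2) by field; rewrite gt_eqF.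
apply: ler_pM; rewrite ?expR_ge0 ?(U0 _ (EX _ E00)) ?leU //; last exact: EX.
rewrite ler_expR.
have -> : 2%:R * (- lam * (t + j%:R)) =
  - (Num.min c mu * t + Num.min c mu * j%:R) by rewrite /lam; field.
by rewrite lerN2 lerD // ler_wpM2r // ge_min lexx ?orbT.
Qed.
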